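(* Let $d\in\mathbb{N}$ and let $\boldsymbol{Y}=(Y_{\boldsymbol{i}})_{\boldsymbol{i}\in\mathbb{Z}^d}$ be a random element of $\mathbb{R}^{\mathbb{Z}^d}_0=\{\boldsymbol{x}\in\mathbb{R}^{\mathbb{Z}^d}: |x_{\boldsymbol{0}}|>1\}$. Then $\boldsymbol{Y}$ is exceedance-stationary if and only if $$\mathbb{E}\left[h(\varphi_{\boldsymbol{k}}\boldsymbol{Y})\mathbf{1}\{|Y_{\boldsymbol{k}}|>1\}\right]=\mathbb{E}\left[h(\boldsymbol{Y})\mathbf{1}\{|Y_{-\boldsymbol{k}}|>1\}\right]$$ for every measurable $h:\mathbb{R}^{\mathbb{Z}^d}\to[0,\infty)$ and all $\boldsymbol{k}\in\mathbb{Z}^d$. In particular, tail processes of stationary random fields are exceedance-stationary.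
   Context: $\mathbb{R}^{\mathbb{Z}^d}$ carries the product $\sigma$-algebra. For $\boldsymbol{k}\in\mathbb{Z}^d$ the shift is $\varphi_{\boldsymbol{k}}\boldsymbol{x}=(x_{\boldsymbol{i}+\boldsymbol{k}})_{\boldsymbol{i}\in\mathbb{Z}^d}$. The set of exceedance-points of $\boldsymbol{x}\in\mathbb{R}^{\mathbb{Z}^d}$ is $\mathrm{e}(\boldsymbol{x})=\{\boldsymbol{k}\in\mathbb{Z}^d:|x_{\boldsymbol{k}}|>1\}$. Exceedance-maps: let $B\subseteq\mathbb{R}^{\mathbb{Z}^d}_0$ be a Borel set such that $\boldsymbol{x}\in B$ and $\boldsymbol{k}\in\mathrm{e}(\boldsymbol{x})$ imply $\varphi_{\boldsymbol{k}}\boldsymbol{x}\in B$. A measurable map $\tau:B\to\mathbb{Z}^d$ is an exceedance-map on $B$ if $\tau(\boldsymbol{x})\in\mathrm{e}(\boldsymbol{x})$ for all $\boldsymbol{x}\in B$. It is bijective on $B$ if, for every $\boldsymbol{x}\in B$, the map $\boldsymbol{k}\mapsto\tau(\boldsymbol{x},\boldsymbol{k}):=\boldsymbol{k}+\tau(\varphi_{\boldsymbol{k}}\boldsymbol{x})$ is a bijection of $\mathrm{e}(\boldsymbol{x})$ onto itself. The associated exceedance-shift is $\varphi_\tau\boldsymbol{x}:=\varphi_{\tau(\boldsymbol{x})}\boldsymbol{x}$. For a random element $\boldsymbol{Y}$ of $\mathbb{R}^{\mathbb{Z}^d}_0$, an exceedance-map is $\boldsymbol{Y}$-bijective if it is bijective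 on some Borel set $B\subseteq\mathbb{R}^{\mathbb{Z}^d}_0$ such that $\boldsymbol{x}\in B$ and $\boldsymbol{k}\in\mathrm{e}(\boldsymbol{x})$ imply $\varphi_{\boldsymbol{k}}\boldsymbol{x}\in B$, and such that $\mathbb{P}(\boldsymbol{Y}\in B)=1$. A random element $\boldsymbol{Y}$ of $\mathbb{R}^{\mathbb{Z}^d}_0$ is exceedance-stationary if $\varphi_\tau\boldsymbol{Y}$ and $\boldsymbol{Y}$ have the same distribution for every $\boldsymbol{Y}$-bijective exceedance-map $\tau$. Tail process: a random field $\boldsymbol{Y}=(Y_{\boldsymbol{i}})_{\boldsymbol{i}\in\mathbb{Z}^d}$ is the tail process of a (strictly) stationary real-valued random field $\boldsymbol{X}=(X_{\boldsymbol{i}})_{\boldsymbol{i}\in\mathbb{Z}^d}$ if $\mathbb{P}(|Y_{\boldsymbol{0}}|>1)=1$ and, for every $m\in\mathbb{N}$, the conditional distribution of $(u^{-1}X_{\boldsymbol{i}})_{\boldsymbol{i}\in\{-m,\dots,m\}^d}$ given $|X_{\boldsymbol{0}}|>u$ converges weakly, as $u\to\infty$, to the distribution of $(Y_{\boldsymbol{i}})_{\boldsymbol{i}\in\{-m,\dots,m\}^d}$. *)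

(* Defs.v *)
From HB Require Import structures.
From mathcomp Require Import all_boot all_order all_algebra.
From mathcomp Require Import all_classical all_reals all_analysis.
Set Implicit Arguments.
Unset Strict Implicit.
Unset Printing Implicit Defensive.
Import Order.TTheory GRing.Theory Num.Theory.
Import numFieldNormedType.Exports.
Local Open Scope classical_set_scope.
Local Open Scope ring_scope.

(* Z^d with the discrete sigma-algebra. *)
Definition lattice (d : nat) : Type := 'rV[int]_d.
HB.instance Definition _ d := GRing.Zmodule.on (lattice d).
HB.instance Definition _ d := Countable.on (lattice d).
HB.instance Definition _ d := isPointed.Build (lattice d) 0.
HB.instance Definition _ d := @isMeasurable.Build default_measure_display
  (lattice d) discrete_measurable discrete_measurable0
  discrete_measurableC discrete_measurableU.

Section product_space.
Context (I : Type) (R : realType).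

Definition coordinate_sets : set (set (I -> R)) :=
  \bigcup_i preimage_set_system [set: I -> R] (fun x => x i) measurable.

(* R^I with its product sigma-algebra; an element of [product_space] is
   (convertibly) a function [I -> R]. *)
Definition product_space := g_sigma_algebraType coordinate_sets.

End product_space.
Arguments product_space : clear implicits.

Notation field_space R d := (product_space (lattice d) R).

Section exceedances.
Context (R : realType) (d : nat).
Implicit Types (x : field_space R d) (k : lattice d).

Definition field_shift k x : field_space R d := fun i => x (i + k).

Definition exceedances x : set (lattice d) := [set k | 1 < `|x k|].

Definition fields0 : set (field_space R d) := [set x | 1 < `|x 0|].

Definition exceedance_domain (B : set (field_space R d)) :=
  [/\ measurable B, B `<=` fields0 &
      forall x k, B x -> exceedances x k -> B (field_shift k x)].

(* A map B -> Z^d is represented by a total function [tau]; no notion below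
   depends on the values of [tau] outside B. *)
Definition exceedance_map (B : set (field_space R d))
    (tau : field_space R d -> lattice d) :=
  [/\ exceedance_domain B, measurable_fun B tau &
      forall x, B x -> exceedances x (tau x)].

Definition bijective_on (B : set (field_space R d))
    (tau : field_space R d -> lattice d) :=
  forall x, B x ->
    set_bij (exceedances x) (exceedances x)
      (fun k => k + tau (field_shift k x)).

Definition exceedance_shift (tau : field_space R d -> lattice d) x :=
  field_shift (tau x) x.

End exceedances.
Arguments fields0 : clear implicits.

Section random_fields.
Context (R : realType) (d : nat).
Context (disp : measure_display) (T : measurableType disp).
Context (P : probability T R).
Implicit Types (X Y : {RV P >-> field_space R d}).

(* [tau], an exceedance-map on [B], is Y-bijective. *)
Definition field_bijective Y (B : set (field_space R d))
    (tau : field_space R d -> lattice d) :=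
  exists B', [/\ exceedance_domain B', B' `<=` B, bijective_on B' tau &
                 P (Y @^-1` B') = 1%E].

(* The shifted field is defined on the almost sure event that Y lies in the
   domain [B] of [tau], hence the intersection with [B]. *)
Definition exceedance_stationary Y :=
  forall B tau, exceedance_map B tau -> field_bijective Y B tau ->
    forall A, measurable A ->
      P [set w | B (Y w) /\ A (exceedance_shift tau (Y w))] =
      distribution P Y A.

Definition stationary X :=
  forall k A, measurable A ->
    pushforward P (fun w => field_shift k (X w)) A = distribution P X A.

End random_fields.

Section weak_convergence.
Context (R : realType) (I : Type).

(* [{ptws I -> R}] carries the product topology. *)
Definition weakly_converges (mu : R -> set (product_space I R) -> \bar R)
    (nu : set (product_space I R) -> \bar R) :=
  forall f : {ptws I -> R} -> R, continuous f ->
    (exists M : R, forall x, `|f x| <= M) ->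
    (\int[mu u]_x (f x)%:E @[u --> +oo%R] -->
     \int[nu]_x (f x)%:E)%E.

End weak_convergence.

(* P ( . | E), meaningful when P E > 0. *)
Definition conditional (disp : measure_display) (T : measurableType disp)
    (R : realType) (P : probability T R) (E : set T) : set T -> \bar R :=
  fun A => (P (A `&` E) * ((fine (P E))^-1)%:E)%E.

Definition window (d m : nat) :=
  {i : lattice d | [forall j, `|i 0 j| <= m%:Z]}.

Definition restrict_window (R : realType) (d m : nat) (x : field_space R d) :
  product_space (window d m) R := fun i => x (val i).
Arguments restrict_window {R d} m x.

(* X and Y may live on different probability spaces. *)
Definition tail_process (R : realType) (d : nat)
    (disp : measure_display) (T : measurableType disp) (P : probability T R)
    (disp' : measure_display) (T' : measurableType disp')
    (P' : probability T' R)
    (X : {RV P' >-> field_space R d}) (Y : {RV P >-> field_space R d}) :=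
  [/\ P [set w | 1 < `|Y w 0|] = 1%E,
      (forall u : R, 0 < u -> (0 < P' [set w | (u < `|X w 0|)%R])%E) &
      forall m : nat,
        weakly_converges
          (fun u => pushforward (conditional P' [set w | (u < `|X w 0|)%R])
             (fun w => restrict_window m (fun i => u^-1 * X w i)))
          (pushforward P (fun w => restrict_window m (Y w)))].

(* Main.v *)
Require Import Defs.
From HB Require Import structures.
From mathcomp Require Import all_boot all_order all_algebra.
From mathcomp Require Import all_classical all_reals all_analysis.
From mathcomp Require Import measurable_realfun.
Set Implicit Arguments.
Unset Strict Implicit.
Unset Printing Implicit Defensive.
Import Order.TTheory GRing.Theory Num.Theory.
Import numFieldNormedType.Exports.
Local Open Scope classical_set_scope.
Local Open Scope ring_scope.

(** Call Y transported if, for every lattice vector k and measurable A,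
    << Y exceeds at k and its shift by k lies in A >> is as likely as
    << Y exceeds at -k and Y lies in A >>.  For indicator functions this is the
    expectation identity, and since it says that the two weighted variables
    have the same law away from 0, it gives the identity for every h
    ([transport_expectationP]).

    Transport implies exceedance-stationarity by splitting according to the
    value k of tau.  The event << tau Y = k and the shifted field is in A >> has
    the form of the left event for k, so it has the probability of
    << Y in A, Y exceeds at -k, and tau takes the value k at the shift of Y by
    -k >>.  As j |-> j + tau (shift by j) is a bijection of the exceedance
    points, exactly one exceedance point j = -k is sent to 0, so these events
    partition << Y in A >> ([transport_exceedance_stationary]).

    Conversely, fix k.  Both sides of the identity only charge fields exceeding
    at 0 and at -k; let D consist of such fields.  If no field of D lies in D
    after a further shift by k, the exceedance points i at which the field
    shifted by i + k is in D can be matched with i + k without conflicts, and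
    [swap] exchanges the two points of each matched pair.  It is a bijective
    exceedance-map, and its invariance is transport on D.  Countably many sets
    without such returns cover all fields that are not k-periodic: a field with
    x i < q <= x (i + k) for some site i and rational q loses this property
    under the shift by k, and likewise with the inequalities reversed
    ([separator]).  On k-periodic fields transport is trivial
    ([stationary_exceedance_transport]).

    For a tail process, stationarity of X gives
    E [F (shift by k of X/u)] = E [F (X/u)].  If F vanishes unless both
    |x 0| > 1 and |x (-k)| > 1, both sides can be conditioned on |X 0| > u, and
    for F continuous, bounded and depending on finitely many sites the limit
    u -> oo yields E [F (shift by k of Y)] = E [F (Y)] ([tail_process_shift]).
    Building the thresholds at 0 and -k into F as continuous factors makes it
    irrelevant whether |Y (-k)| has an atom at 1.  Products of ramps increase to
    indicators of finite intersections of half-spaces, a pi-system generating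
    the product sigma-algebra, whence transport ([tail_exceedance_transport]). *)

(** * Product sigma-algebra and shifts *)

Section product_space_measurability.
Context (I : Type) (R : realType).

Lemma measurable_coordinate (i : I) :
  measurable_fun [set: product_space I R] (fun x => x i).
Proof.
move=> _ B mB; rewrite setTI; apply: sub_sigma_algebra.
by exists i => //; exists B => //; rewrite setTI.
Qed.

Lemma measurable_fun_product (disp : measure_display)
    (T : measurableType disp) (D : set T) (f : T -> product_space I R) :
  (forall i, measurable_fun D (fun w => f w i)) -> measurable_fun D f.
Proof.
move=> mf; move=> mD; have mE : @measurable _ (product_space I R) =
  <<s @coordinate_sets I R >> by [].
refine (measurability _ mE _ mD).
move=> _ [_ [i _ [B mB <-]] <-]; rewrite setTI.
exact: (mf i mD).
Qed.

(** A constraint is a pair of a site and a lower bound; lists make the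
    intersection of two sets a concatenation, even with repeated sites. *)
Definition ray_cylinders : set (set (product_space I R)) :=
  [set A | exists s : seq (I * R),
     A = [set x | all (fun p => p.2 < x p.1) s]].

Lemma setI_closed_ray_cylinders : setI_closed ray_cylinders.
Proof.
move=> _ _ [s ->] [t ->]; exists (s ++ t); apply/seteqP.
by split=> x /=; rewrite all_cat => /andP.
Qed.

Lemma measurable_ray_cylinder (s : seq (I * R)) :
  measurable [set x : product_space I R | all (fun p => p.2 < x p.1) s].
Proof.
elim: s => [|p s IHs] /=.
  by rewrite [X in measurable X](_ : _ = setT)//; apply/seteqP; split.
rewrite [X in measurable X](_ : _ =
  (fun x : product_space I R => x p.1) @^-1` `]p.2, +oo[ `&`
  [set x | all (fun p => p.2 < x p.1) s]); last first.
  by apply/seteqP; split=> x /=; rewrite in_itv/= andbT => /andP.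
apply: measurableI => //; rewrite -[X in measurable X]setTI.
exact: measurable_coordinate.
Qed.

Lemma measurable_ray_cylinders :
  @measurable _ (product_space I R) = <<s ray_cylinders >>.
Proof.
apply/seteqP; split; last first.
  apply: smallest_sub; first exact: sigma_algebra_measurable.
  by move=> _ [s ->]; exact: measurable_ray_cylinder.
apply: smallest_sub; first exact: smallest_sigma_algebra.
move=> _ [i _ [B mB <-]].
suff mi : measurable_fun setT
  (fun x : g_sigma_algebraType ray_cylinders => x i) by exact: mi.
move=> mT.
refine (measurability _ (RGenOInfty.measurableE R) _ mT).
move=> _ [_ [a ->] <-]; apply: sub_sigma_algebra.
exists [:: (i, a)]; apply/seteqP; split=> x /=; rewrite in_itv/= !andbT; tauto.
Qed.

End product_space_measurability.

Section field_measurability.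
Context (R : realType) (d : nat).

Lemma measurable_field_shift (k : lattice d) :
  measurable_fun [set: field_space R d] (field_shift k).
Proof. by apply: measurable_fun_product => i; exact: measurable_coordinate. Qed.

Lemma measurable_field_shift_preimage (k : lattice d)
    (A : set (field_space R d)) :
  measurable A -> measurable [set x | A (field_shift k x)].
Proof.
by move=> mA; rewrite -[X in measurable X]setTI; exact: measurable_field_shift.
Qed.

Lemma measurable_exceedance (k : lattice d) :
  measurable [set x : field_space R d | 1 < `|x k|].
Proof.
rewrite [X in measurable X](_ : _ =
  (fun x : field_space R d => `|x k|) @^-1` `]1, +oo[); last first.
  by apply/seteqP; split=> x /=; rewrite in_itv/= andbT.
rewrite -[X in measurable X]setTI; apply: measurableT_comp => //.
exact: measurable_coordinate.
Qed.

Lemma field_shiftD (j k : lattice d) (x : field_space R d) :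
  field_shift j (field_shift k x) = field_shift (j + k) x.
Proof. by apply/funext => i; rewrite /field_shift addrA. Qed.

Lemma field_shift0 (x : field_space R d) : field_shift 0 x = x.
Proof. by apply/funext => i; rewrite /field_shift addr0. Qed.

Lemma field_shiftK (k : lattice d) (x : field_space R d) :
  field_shift k (field_shift (- k) x) = x.
Proof. by rewrite field_shiftD subrr field_shift0. Qed.

Lemma exceedance_domain_fields0 : exceedance_domain (fields0 R d).
Proof.
split => //; first exact: measurable_exceedance.
by move=> x k _; rewrite /exceedances /fields0/= /field_shift add0r.
Qed.

Lemma countable_lattice : countable [set: lattice d].
Proof. exact: countableP. Qed.

End field_measurability.

(** * Comparison of measures and of expectations *)

Section measure_lemmas.
Local Open Scope ereal_scope.
Context (disp : measure_display) (T : measurableType disp) (R : realType).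

Lemma probability1_setI (P : probability T R) (A N : set T) :
  measurable A -> measurable N -> P N = 1 -> P (A `&` N) = P A.
Proof.
move=> mA mN PN; have PNC : P (~` N) = 0.
  by rewrite probability_setC// PN subee.
rewrite -[in RHS](setIT A) -(setUv N) setIUr measureU0//.
- exact: measurableI.
- by apply: measurableI => //; exact: measurableC.
- apply: (@subset_measure0 _ _ _ P _ (~` N)) => //.
  + by apply: measurableI => //; exact: measurableC.
  + exact: measurableC.
Qed.

Lemma eq_probability1 (P : probability T R) (A B N : set T) :
  measurable A -> measurable B -> measurable N -> P N = 1 ->
  A `&` N = B `&` N -> P A = P B.
Proof.
move=> mA mB mN PN AB.
rewrite -(probability1_setI (P := P) (A := A) (N := N))//.
by rewrite AB probability1_setI.
Qed.

(* [pickle_inv] is injective where defined, so that disjointness survives the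
   reindexing by natural numbers. *)
Let pickled (I : countType) (E : I -> set T) (n : nat) :=
  if pickle_inv n is Some i then E i else set0.

Let bigcup_pickled (I : countType) (E : I -> set T) :
  \bigcup_n pickled E n = \bigcup_i E i.
Proof.
apply/seteqP; split=> [x [n _]|x [i _ Ei]].
  by rewrite /pickled; case: pickle_inv => // i Ei; exists i.
by exists (pickle i) => //; rewrite /pickled pickleK_inv.
Qed.

Let measurable_pickled (I : countType) (E : I -> set T) :
  (forall i, measurable (E i)) -> forall n, measurable (pickled E n).
Proof. by move=> mE n; rewrite /pickled; case: pickle_inv. Qed.

Lemma eq_measure_bigcup (I : countType) (m1 m2 : {measure set T -> \bar R})
    (E F : I -> set T) :
  (forall i, measurable (E i)) -> (forall i, measurable (F i)) ->
  trivIset setT E -> trivIset setT F -> (forall i, m1 (E i) = m2 (F i)) ->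
  m1 (\bigcup_i E i) = m2 (\bigcup_i F i).
Proof.
move=> mE mF tE tF EF.
have tpick (G : I -> set T) : trivIset setT G -> trivIset setT (pickled G).
  move=> tG m n _ _; rewrite /pickled.
  case: (pickle_inv m) (@pickle_invK I m) => [i <-|_ [x []//]].
  case: (pickle_inv n) (@pickle_invK I n) => [j <-|_ [x []//]].
  by move=> /(tG i j Logic.I Logic.I) ->.
rewrite -(bigcup_pickled E) -(bigcup_pickled F).
rewrite !measure_bigcup//; try exact: tpick;
  try (by move=> n _; exact: measurable_pickled).
apply: eq_eseriesr => n _; rewrite /pickled; case: pickle_inv => //.
by rewrite !measure0.
Qed.

(** Measures that agree below each member of a countable cover agree: the
    disjointified pieces still lie below members of the cover. *)
Lemma eq_measure_cover (I : countType) (m1 m2 : {measure set T -> \bar R})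
    (U : I -> set T) :
  (forall i, measurable (U i)) -> \bigcup_i U i = setT ->
  (forall i A, measurable A -> A `<=` U i -> m1 A = m2 A) ->
  forall A, measurable A -> m1 A = m2 A.
Proof.
move=> mU UT m12 A mA.
have -> : A = \bigcup_n (A `&` seqDU (pickled U) n).
  by rewrite -setI_bigcupr -seqDU_bigcup_eq bigcup_pickled UT setIT.
have mD n : measurable (A `&` seqDU (pickled U) n).
  apply: measurableI => //; apply: measurableD; first exact: measurable_pickled.
  by apply: bigsetU_measurable => i _; exact: measurable_pickled.
apply: eq_measure_bigcup => //.
- by apply: trivIset_setIl; exact: trivIset_seqDU.
- by apply: trivIset_setIl; exact: trivIset_seqDU.
move=> n; have : A `&` seqDU (pickled U) n `<=` pickled U n.
  by move=> x [_]; exact: subset_seqDU.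
rewrite {2}/pickled; case: pickle_inv => [i|]; first exact: m12.
by rewrite subset0 => ->; rewrite !measure0.
Qed.

Lemma eq_law_expectation (P : probability T R) (X1 X2 : T -> R) :
  measurable_fun setT X1 -> measurable_fun setT X2 ->
  (forall w, (0 <= X1 w)%R) -> (forall w, (0 <= X2 w)%R) ->
  (forall S, measurable S -> P (X1 @^-1` S) = P (X2 @^-1` S)) ->
  'E_P[X1] = 'E_P[X2].
Proof.
move=> mX1 mX2 X1_ge0 X2_ge0 X12; rewrite unlock.
have normE (X : T -> R) : measurable_fun setT X -> (forall w, (0 <= X w)%R) ->
    \int[P]_w (X w)%:E = \int[pushforward P X]_x (`|x|%R)%:E.
  move=> mX X0; rewrite ge0_integral_pushforward//; last first.
    exact/measurable_EFinP.
  by rewrite preimage_setT; apply: eq_integral => w _ /=; rewrite ger0_norm.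
rewrite !normE//; apply: eq_measure_integral => S mS _.
exact: X12.
Qed.

End measure_lemmas.

(** * The transport identity *)

Section exceedance_transport.
Context (R : realType) (d : nat) (disp : measure_display)
  (T : measurableType disp) (P : probability T R)
  (Y : {RV P >-> field_space R d}).

(** The two sides of the transport identity are the measures
    [exceedance_law k k] and [exceedance_law (- k) 0]; a common formula gives
    both of them their measure structure at once. *)
Definition exceedance_law (j k : lattice d) (A : set (field_space R d)) :=
  P [set w | 1 < `|Y w j| /\ A (field_shift k (Y w))].

Definition exceedance_transport := forall (k : lattice d) A, measurable A ->
  P [set w | 1 < `|Y w k| /\ A (field_shift k (Y w))] =
  P [set w | 1 < `|Y w (- k)| /\ A (Y w)].

Lemma measurable_event (A : set (field_space R d)) :
  measurable A -> measurable [set w | A (Y w)].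
Proof.
by move=> mA; rewrite -[X in measurable X]setTI; exact: (measurable_funP Y).
Qed.

Lemma measurable_transport_source (j k : lattice d)
    (A : set (field_space R d)) :
  measurable A -> measurable [set w | 1 < `|Y w j| /\ A (field_shift k (Y w))].
Proof.
move=> mA; apply: (measurable_event (A :=
  ([set x | 1 < `|x j|] `&` [set x | A (field_shift k x)]))).
by apply: measurableI; [exact: measurable_exceedance|
                        exact: measurable_field_shift_preimage].
Qed.

Lemma measurable_transport_target (k : lattice d) (A : set (field_space R d)) :
  measurable A -> measurable [set w | 1 < `|Y w k| /\ A (Y w)].
Proof.
move=> mA; apply: (measurable_event (A := [set x | 1 < `|x k|] `&` A)).
by apply: measurableI => //; exact: measurable_exceedance.
Qed.

Section exceedance_law_measure.
Variables j k : lattice d.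

Let exceedance_law0 : exceedance_law j k set0 = 0%E.
Proof.
rewrite /exceedance_law (_ : [set _ | _] = set0) ?measure0//.
by apply/seteqP; split=> w [].
Qed.

Let exceedance_law_ge0 A : (0 <= exceedance_law j k A)%E.
Proof. exact: measure_ge0. Qed.

Let exceedance_law_sigma_additive : semi_sigma_additive (exceedance_law j k).
Proof.
move=> F mF tF mUF; rewrite /exceedance_law.
rewrite [X in _ --> P X](_ : _ =
    \bigcup_n [set w | 1 < `|Y w j| /\ F n (field_shift k (Y w))]); last first.
  apply/seteqP; split=> [w [Yj [n _ Fn]]|w [n _ [Yj Fn]]]; first by exists n.
  by split => //; exists n.
apply: measure_sigma_additive.
  by move=> n; exact: measurable_transport_source.
move=> m n _ _ [w [[_ Fm] [_ Fn]]].
by apply: (tF m n) => //; exists (field_shift k (Y w)).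
Qed.

HB.instance Definition _ := isMeasure.Build _ _ _ (exceedance_law j k)
  exceedance_law0 exceedance_law_ge0 exceedance_law_sigma_additive.

End exceedance_law_measure.

Lemma exceedance_law_fin (j k : lattice d) (A : set (field_space R d)) :
  measurable A -> (exceedance_law j k A < +oo)%E.
Proof.
move=> mA; rewrite (le_lt_trans _ (ltry 1))//; apply: probability_le1.
exact: measurable_transport_source.
Qed.

Lemma exceedance_lawP :
  (forall k A, measurable A ->
    exceedance_law k k A = exceedance_law (- k) 0 A) ->
  exceedance_transport.
Proof.
move=> lawE k A /(lawE k); rewrite /exceedance_law => ->; congr (P _).
by apply/seteqP; split=> w /=; rewrite field_shift0.
Qed.

Lemma exceedance_indicE (k : lattice d) (x : field_space R d) :
  (1 < `|x k|)%R%:R = \1_[set x : field_space R d | 1 < `|x k|] x :> R.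
Proof.
by rewrite indicE; congr ((nat_of_bool _)%:R); apply/idP/idP; rewrite inE.
Qed.

Lemma measurable_weighted (j : lattice d) (h : field_space R d -> R)
    (f : field_space R d -> field_space R d) :
  measurable_fun setT h -> measurable_fun setT f ->
  measurable_fun setT
    (fun w => h (f (Y w)) * (1 < `|Y w j|)%R%:R).
Proof.
move=> mh mf.
apply: (measurableT_comp (f := fun x : field_space R d =>
  h (f x) * (1 < `|x j|)%R%:R)) => //.
apply: measurable_funM.
  exact: measurableT_comp.
rewrite [X in measurable_fun _ X](_ : _ =
    \1_[set x : field_space R d | 1 < `|x j|]).
  by apply: measurable_indic; exact: measurable_exceedance.
by apply/funext => x; exact: exceedance_indicE.
Qed.

(** Both variables have the form v * b with b boolean; transport controls the
    events << b and v in S >>, which are the preimages of S when 0 is not in S.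
    The case of 0 in S follows by complementation. *)
Lemma transport_expectationP : exceedance_transport <->
  forall h : field_space R d -> R,
    measurable_fun [set: field_space R d] h -> (forall x, 0 <= h x) ->
    forall k : lattice d,
      ('E_P[(fun w => h (field_shift k (Y w)) * (1 < `|Y w k|)%R%:R)%R] =
       'E_P[(fun w => h (Y w) * (1 < `|Y w (- k)|)%R%:R)%R])%E.
Proof.
split=> [tY h mh h_ge0 k|EY k A mA].
  have m1 := measurable_weighted k mh (@measurable_field_shift R d k).
  have m2 := measurable_weighted (- k) mh (@measurable_id _ _ setT).
  apply: eq_law_expectation => //; try (by move=> w; rewrite mulr_ge0).
  pose X1 w := h (field_shift k (Y w)) * (1 < `|Y w k|)%R%:R.
  pose X2 w := h (Y w) * (1 < `|Y w (- k)|)%R%:R.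
  have preimageE (u v : T -> R) (b : T -> bool) (S : set R) : ~ S 0 ->
      u = (fun w => v w * (b w)%:R) -> u @^-1` S = [set w | b w /\ S (v w)].
    move=> S0 ->; apply/seteqP; split=> w /=; case: (b w).
    - by rewrite mulr1.
    - by rewrite mulr0.
    - by rewrite mulr1 => -[].
    - by case.
  have eqX (S : set R) : measurable S -> ~ S 0 ->
      P (X1 @^-1` S) = P (X2 @^-1` S).
    move=> mS S0; rewrite (preimageE _ _ _ _ S0 (erefl X1)).
    rewrite (preimageE _ _ _ _ S0 (erefl X2)).
    apply: (tY k (h @^-1` S)).
    by rewrite -[X in measurable X]setTI; exact: mh.
  move=> S mS; have [S0|] := pselect (S 0); last exact: eqX.
  have PC (X : T -> R) : measurable_fun setT X ->
      P (X @^-1` S) = (1 - P (X @^-1` (~` S)))%E.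
    move=> mX; rewrite -probability_setC.
      by rewrite preimage_setC setCK.
    by rewrite -[X in measurable X]setTI; apply: mX => //; exact: measurableC.
  rewrite !PC//.
  by congr (_ - _)%E; apply: eqX; [exact: measurableC|apply].
have := EY \1_A (measurable_indic mA) _ k.
have indicE (j : lattice d) 
    (f : field_space R d -> field_space R d) :
    measurable [set w | 1 < `|Y w j| /\ A (f (Y w))] ->
    ('E_P[(fun w => \1_A (f (Y w)) * (1 < `|Y w j|)%R%:R)%R] =
    P [set w | (1 < `|Y w j|)%R /\ A (f (Y w))])%E.
  move=> mE; rewrite -expectation_indic//; congr (expectation P _).
  apply/funext => w; rewrite !indicE -natrM mulnb; congr ((nat_of_bool _)%:R).
  by apply/idP/idP; [move=> /andP[/set_mem ? ?]; rewrite inE|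
    rewrite inE => -[? ?]; apply/andP; split => //; rewrite inE].
rewrite (indicE k (field_shift k)); last exact: measurable_transport_source.
rewrite (indicE (- k) id); last exact: measurable_transport_target.
by apply.
Qed.

End exceedance_transport.

(** * Transport implies exceedance-stationarity *)

Section transport_stationary.
Context (R : realType) (d : nat) (disp : measure_display)
  (T : measurableType disp) (P : probability T R)
  (Y : {RV P >-> field_space R d}).

(** Mass is sent from Y to its shift by tau Y; bijectivity says that each field
    receives mass from exactly one of its exceedance points. *)
Lemma transport_exceedance_stationary :
  exceedance_transport Y -> exceedance_stationary Y.
Proof.
move=> tY B tau [[mB _ _] mtau tauE].
move=> [B' [[mB' B'0 B'shift] B'B bijB' PB']] A mA.
have mtauk k : measurable (B `&` tau @^-1` [set k]) by exact: mtau.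
have mtau' k : measurable (B' `&` tau @^-1` [set k]).
  rewrite -(setIidl B'B) -setIA; exact: measurableI.
have mYB' : measurable (Y @^-1` B') by exact: measurable_event.
(* The fields of A that tau reaches from their own shift by -k. *)
pose S k : set (field_space R d) :=
  [set x | [/\ B' (field_shift (- k) x), tau (field_shift (- k) x) = k & A x]].
have mS k : measurable (S k).
  rewrite (_ : S k =
    [set x | (B' `&` tau @^-1` [set k]) (field_shift (- k) x)] `&` A).
    by apply: measurableI => //; exact: measurable_field_shift_preimage.
  by apply/seteqP; split=> x /=; rewrite /S/=; [case|case=> -[]].
pose E k := [set w | 1 < `|Y w k| /\ S k (field_shift k (Y w))].
pose F k := [set w | 1 < `|Y w (- k)| /\ S k (Y w)] `&` Y @^-1` B'.
have mE k : measurable (E k) by exact: measurable_transport_source.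
have mF k : measurable (F k).
  by apply: measurableI => //; exact: measurable_transport_target.
have EE k w : E k w <-> [/\ B' (Y w), tau (Y w) = k & A (field_shift k (Y w))].
  rewrite /E /S /= field_shiftD addNr field_shift0; split=> [[]//|[B'w tk Aw]].
  by split=> //; rewrite -tk; apply: (tauE _ (B'B _ B'w)).
have tE : trivIset setT E.
  by move=> j k _ _ [w [/EE [_ <- _] /EE [_ <- _]]].
have tF : trivIset setT F.
  move=> j k _ _ [w [[[Yj [_ tj _]] B'w] [[Yk [_ tk _]] _]]].
  have [_ inj _] := bijB' _ B'w.
  apply: oppr_inj; apply: inj; rewrite ?inE//.
  by rewrite tj tk !addNr.
have EF k : P (E k) = P (F k).
  rewrite [RHS]probability1_setI//; last exact: measurable_transport_target.
  exact: tY.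
have FE : \bigcup_k F k = Y @^-1` A `&` Y @^-1` B'.
  apply/seteqP; split=> [w [k _ [[_ [_ _ Aw]] B'w]]//|w [Aw B'w]].
  (* The exceedance point sent to the origin determines the shift. *)
  have [_ _ surj] := bijB' _ B'w.
  have /surj [j ej jE] : exceedances (Y w) 0 by exact: B'0.
  exists (- j) => //; split => //; split; rewrite /S/= opprK//.
  split=> //; first exact: B'shift.
  by apply/eqP; rewrite -addr_eq0 addrC; apply/eqP.
transitivity (P (\bigcup_k E k)); last first.
  rewrite (eq_measure_bigcup mE mF tE tF EF) FE.
  by apply: probability1_setI => //; exact: measurable_event.
apply: (eq_probability1 (N := Y @^-1` B')) => //.
- rewrite (_ : [set _ | _] = \bigcup_k [set w |
    ((B `&` tau @^-1` [set k]) `&` [set x | A (field_shift k x)]) (Y w)]).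
    apply: countable_bigcupT_measurable; first exact: countable_lattice.
    move=> k; apply: measurable_event; apply: measurableI => //.
    exact: measurable_field_shift_preimage.
  apply/seteqP; split=> [w [Bw Aw]|w [k _ [[Bw /= <-] Aw]]//].
  by exists (tau (Y w)).
- by apply: countable_bigcupT_measurable; first exact: countable_lattice.
- apply/seteqP; split=> [w [[Bw Aw] B'w]|w [[k _ /EE[_ <- Aw]] B'w]].
    by split=> //; exists (tau (Y w)) => //; apply/EE.
  by split=> //; split=> //; exact: B'B.
Qed.

End transport_stationary.

(** * Swaps and separating sets *)

Section swap_map.
Context (R : realType) (d : nat).

(** The exceedance-map that exchanges the sites 0 and k when the shift by k
    lies in D, hence the sites 0 and -k when the field itself lies in D. *)
Definition swap (k : lattice d) (D : set (field_space R d))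
    (x : field_space R d) : lattice d :=
  if field_shift k x \in D then k else if x \in D then - k else 0.

Section swap_theory.
Context (k : lattice d) (D : set (field_space R d)).
Hypothesis mD : measurable D.
Hypothesis DE : forall x, D x -> 1 < `|x 0| /\ 1 < `|x (- k)|.
Hypothesis Dk : forall x, D x -> ~ D (field_shift k x).

Lemma measurable_swap : measurable_fun setT (swap k D).
Proof.
apply: measurable_fun_ifT => //; last apply: measurable_fun_ifT => //.
- apply: (measurable_fun_bool true); rewrite setTI.
  rewrite [X in measurable X](_ : _ = [set x | D (field_shift k x)]).
    exact: measurable_field_shift_preimage.
  by apply/seteqP; split=> x /=; [exact: set_mem|exact: mem_set].
- apply: (measurable_fun_bool true); rewrite setTI.
  rewrite [X in measurable X](_ : _ = D)//.
  by apply/seteqP; split=> x /=; [exact: set_mem|exact: mem_set].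
Qed.

Lemma swap_exceedance x : fields0 R d x -> exceedances x (swap k D x).
Proof.
rewrite /swap; case: ifPn => [/set_mem/DE[+ _] _|_].
  by rewrite /field_shift add0r.
by case: ifPn => [/set_mem/DE[_ +] _|].
Qed.

(** A site is matched at most once, since D does not meet its shift by k; the
    induced map on sites is then an exchange of matched pairs. *)
Lemma swap_involutive x :
  involutive (fun j : lattice d => j + swap k D (field_shift j x)).
Proof.
have DN y : y \in D -> field_shift k y \notin D.
  by rewrite inE => /Dk Dy; apply/negP; rewrite inE.
have addKl (a b : lattice d) : a + b - a = b by rewrite addrAC subrr add0r.
move=> j; rewrite /swap !field_shiftD.
have [Dj|Dj] := boolP (field_shift (k + j) x \in D).
  have := DN _ Dj; rewrite field_shiftD => /negbTE.
  rewrite [j + k]addrC => ->.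
  by rewrite Dj; exact: addKl.
have [Dj'|Dj'] := boolP (field_shift j x \in D).
  have -> : k + (j - k) = j by rewrite addrC subrK.
  by rewrite Dj' subrK.
by rewrite !addr0 (negbTE Dj) (negbTE Dj') addr0.
Qed.

Lemma swap_bijective_on : Defs.bijective_on (fields0 R d) (swap k D).
Proof.
move=> x x0; have sE j : exceedances x j ->
    exceedances x (j + swap k D (field_shift j x)).
  move=> xj; have := @swap_exceedance (field_shift j x).
  by rewrite /fields0 /exceedances /field_shift /= add0r addrC; apply.
split=> [j /sE//|j j' _ _|j xj].
  exact: (inv_inj (swap_involutive x)).
by exists (j + swap k D (field_shift j x)); [exact: sE|exact: swap_involutive].
Qed.

(** A field of D can be reached by the swap only from the other member of its
    pair: starting from D, the swap leaves D. *)
Lemma swap_shift x : D (exceedance_shift (swap k D) x) <-> D (field_shift k x).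
Proof.
rewrite /exceedance_shift /swap; case: ifPn => [//|kxD].
case: ifPn => [/set_mem xD|xD].
  split=> [/Dk|/mem_set xD']; first by rewrite field_shiftK.
  by rewrite xD' in kxD.
rewrite field_shift0; split=> /mem_set xD'; first by rewrite xD' in xD.
by rewrite xD' in kxD.
Qed.

End swap_theory.

End swap_map.

Section separators.
Context (R : realType) (d : nat).

(** Countably many sets covering the field space: the k-periodic fields, and
    the fields that cross a given rational level, upwards or downwards,
    between the sites i and i + k. *)
Definition separator (k : lattice d) (c : option (lattice d * rat * bool)) :
    set (field_space R d) :=
  match c with
  | None => [set x | field_shift k x = x]
  | Some (i, q, false) => [set x | x i < ratr q <= x (i + k)]
  | Some (i, q, true) => [set x | x (i + k) < ratr q <= x i]
  end.

Lemma measurable_separator k c : measurable (separator k c).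
Proof.
have lt_le i j (q : R) : measurable [set x : field_space R d | x i < q <= x j].
  rewrite (_ : [set _ | _] = (fun x : field_space R d => x i) @^-1` `]-oo, q[
      `&` (fun x : field_space R d => x j) @^-1` `[q, +oo[).
    by apply: measurableI; rewrite -[X in measurable X]setTI;
      exact: measurable_coordinate.
  apply/seteqP; split=> x /=; rewrite !in_itv/= andbT; first by move/andP.
  by case=> -> ->.
have mlt i j :
    measurable [set x : field_space R d | x i < x j].
  rewrite (_ : [set _ | _] = \bigcup_(q : rat)
      [set x : field_space R d | x i < ratr q <= x j]).
    by apply: countable_bigcupT_measurable.
  apply/seteqP; split=> [x /= ij|x [q _ /andP[]]].
    have [q] := rat_in_itvoo ij; rewrite in_itv/= => /andP[iq qj].
    by exists q => //=; rewrite iq ltW.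
  exact: lt_le_trans.
case: c => [[[i q] []]|]; [exact: lt_le|exact: lt_le|].
rewrite (_ : separator k None = ~` \bigcup_i
    ([set x : field_space R d | x i < x (i + k)] `|`
     [set x | x (i + k) < x i])).
  apply: measurableC; apply: countable_bigcupT_measurable.
    exact: countable_lattice.
  by move=> i; apply: measurableU; exact: mlt.
apply/seteqP; split=> x /=.
  by move=> kx [i _ /=]; rewrite -{1}kx -{4}kx /field_shift !ltxx; case.
move=> xN; apply/funext => i; apply/eqP; apply: contra_notT xN.
by rewrite /field_shift neq_lt => /orP[?|?]; exists i => //; [right|left].
Qed.

Lemma separator_cover k : \bigcup_c separator k c = setT.
Proof.
apply/seteqP; split=> // x _.
have [kx|kx] := pselect (field_shift k x = x); first by exists None.
have [i] : exists i, field_shift k x i != x i.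
  by apply: contra_notP kx => xE; apply/funext => i; apply/eqP;
    apply: contra_notT xE => ?; exists i.
rewrite /field_shift neq_lt => /orP[] /rat_in_itvoo[q];
  rewrite in_itv/= => /andP[lq qr].
  by exists (Some (i, q, true)) => //=; rewrite lq ltW.
by exists (Some (i, q, false)) => //=; rewrite lq ltW.
Qed.

(** A field that crosses the level q between i and i + k is past q at i + k,
    where the shifted field would have to start its own crossing. *)
Lemma separator_shift k c x :
  separator k (Some c) x -> ~ separator k (Some c) (field_shift k x).
Proof.
case: c => [[i q] []] /= /andP[xl xr]; rewrite /field_shift => /andP[yl yr].
  by move: (lt_le_trans xl yr); rewrite ltxx.
by move: (lt_le_trans yl xr); rewrite ltxx.
Qed.

End separators.

(** * Exceedance-stationarity implies transport *)

Lemma stationary_exceedance_transport (R : realType) (d : nat)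
    (disp : measure_display) (T : measurableType disp) (P : probability T R)
    (Y : {RV P >-> field_space R d}) :
  P (Y @^-1` fields0 R d) = 1%E ->
  exceedance_stationary Y -> exceedance_transport Y.
Proof.
move=> Y0 sY.
have m0 : measurable (Y @^-1` fields0 R d).
  by apply: measurable_event; exact: (measurable_exceedance 0).
apply: exceedance_lawP => k; apply: (eq_measure_cover (U := separator k)).
- exact: measurable_separator.
- exact: separator_cover.
move=> [c|] A mA AU.
  (* Both measures only charge fields exceeding at 0 and at -k. *)
  pose D := A `&` [set x | 1 < `|x 0| /\ 1 < `|x (- k)|].
  have mD : measurable D.
    apply: measurableI => //.
    by apply: measurableI; exact: measurable_exceedance.
  have DE x : D x -> 1 < `|x 0| /\ 1 < `|x (- k)| by case.
  have Dk x : D x -> ~ D (field_shift k x).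
    by move=> [/AU xc _] [/AU yc _]; exact: separator_shift xc yc.
  have swapP : exceedance_map (fields0 R d) (swap k D).
    split; first exact: exceedance_domain_fields0.
      by apply: measurable_funTS; exact: measurable_swap.
    exact: swap_exceedance.
  have swapY : field_bijective Y (fields0 R d) (swap k D).
    exists (fields0 R d); split => //; first exact: exceedance_domain_fields0.
    exact: swap_bijective_on.
  transitivity (P [set w | 1 < `|Y w 0| /\ D (field_shift k (Y w))]).
    apply: (eq_probability1 (N := Y @^-1` fields0 R d)) => //.
    - exact: measurable_transport_source.
    - exact: measurable_transport_source.
    apply/seteqP; split=> w; rewrite /D /fields0 /= /field_shift add0r addNr.
      by tauto.
    by tauto.
  transitivity (distribution P Y D).
    rewrite -(sY _ _ swapP swapY _ mD); congr (P _).
    by apply/seteqP; split=> w [Yw Dw]; split=> //; exact/(swap_shift Dk).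
  apply: (eq_probability1 (N := Y @^-1` fields0 R d)) => //.
  - exact: measurable_event.
  - exact: measurable_transport_source.
  apply/seteqP; split=> w; rewrite /D /fields0 /= field_shift0.
    by tauto.
  by tauto.
apply: (eq_probability1 (N := Y @^-1` fields0 R d)) => //.
- exact: measurable_transport_source.
- exact: measurable_transport_source.
have Y0k w : field_shift k (Y w) = Y w -> Y w k = Y w 0 /\ Y w (- k) = Y w 0.
  move=> Yw; have e i : Y w i = Y w (i + k) by rewrite -{1}Yw.
  by split; [rewrite (e 0) add0r|rewrite (e (- k)) addNr].
apply/seteqP; split=> w [[/= Yk Aw] Yw0]; move: (AU _ Aw) => /= per.
  have Yw : field_shift k (Y w) = Y w.
    rewrite -[RHS](field_shift0 (Y w)) -(addNr k) -field_shiftD -{2}per.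
    by rewrite !field_shiftD addNr add0r.
  by rewrite field_shift0 -{2}Yw; split=> //; split=> //; rewrite (Y0k _ Yw).2.
have Yw : field_shift k (Y w) = Y w by move: per; rewrite field_shift0.
rewrite field_shift0 in Aw; rewrite Yw.
by split=> //; split=> //; rewrite (Y0k _ Yw).1.
Qed.

(** * Weak limits at high levels *)

Section integral_lemmas.
Local Open Scope ereal_scope.
Context (disp : measure_display) (T : measurableType disp) (R : realType).

Lemma integral_vanish_outside (m : {measure set T -> \bar R}) (E : set T)
    (f : T -> \bar R) :
  (forall w, ~ E w -> f w = 0) -> \int[m]_w f w = \int[m]_(w in E) f w.
Proof.
move=> f0; rewrite [RHS]integral_mkcond; congr integral; apply/funext => w.
by rewrite /patch; case: ifPn => // /negP; rewrite inE => /f0.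
Qed.

(** For f vanishing off the conditioning event, conditioning only rescales. *)
Lemma integral_conditional_pushforward (disp' : measure_display)
    (T' : measurableType disp') (P : probability T R) (E : set T)
    (phi : T -> T') (f : T' -> \bar R) :
  measurable E -> measurable_fun setT phi ->
  measurable_fun setT f -> (forall y, 0 <= f y) ->
  (forall w, ~ E w -> f (phi w) = 0) ->
  \int[pushforward (conditional P E) phi]_y f y =
  ((fine (P E))^-1)%:E * \int[P]_w f (phi w).
Proof.
move=> mE mphi mf f0 fE.
have c0 : (0 <= (fine (P E))^-1)%R by rewrite invr_ge0 fine_ge0.
pose c : {nonneg R} := NngNum c0.
have -> : conditional P E = mscale c (mrestr P mE).
  by apply/funext => A; rewrite /conditional /mscale /= /mrestr muleC.
have mfphi : measurable_fun setT (f \o phi) by exact: measurableT_comp.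
rewrite (ge0_integral_pushforward mphi)//.
rewrite preimage_setT ge0_integral_mscale//; last by move=> w _; exact: f0.
congr (_ * _); rewrite [LHS](@integral_vanish_outside _ E)//.
rewrite [RHS](@integral_vanish_outside _ E)//.
apply: eq_measure_integral => A mA AE.
by rewrite /= /mrestr setIidl.
Qed.

End integral_lemmas.

Section product_tests.
Context (R : realType) (I : eqType).
Variables (g : I -> R -> R).
Hypothesis cg : forall i, continuous (g i).
Hypothesis g_ge0 : forall i t, 0 <= g i t.
Hypothesis g_le1 : forall i t, g i t <= 1.

(** The factors are indexed by a separate type I, so that several factors can
    look at the same site; the index type J of the field is a parameter because
    the same product is used on a window and on the whole lattice. *)
Definition product_test (J : Type) (s : seq I) (site : I -> J) (x : J -> R) :=
  \prod_(i <- s) g i (x (site i)).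

Lemma product_test_ge0 J s (site : I -> J) x : 0 <= product_test s site x.
Proof. by apply: prodr_ge0. Qed.

Lemma product_test_le1 J s (site : I -> J) x : product_test s site x <= 1.
Proof. by apply: prodr_ile1 => i _; rewrite g_ge0 g_le1. Qed.

Lemma measurable_product_test J s (site : I -> J) :
  measurable_fun setT (product_test s site : product_space J R -> R).
Proof.
elim: s => [|i s IHs].
  rewrite (_ : product_test _ _ = cst 1)//.
  by apply/funext => x; rewrite /product_test big_nil.
rewrite (_ : product_test _ _ = fun x : product_space J R =>
    g i (x (site i)) * product_test s site x); last first.
  by apply/funext => x; rewrite /product_test big_cons.
apply: measurable_funM => //.
apply: (measurableT_comp (f := g i)); last exact: measurable_coordinate.
exact: continuous_measurable_fun.
Qed.

Lemma continuous_product_test (J : eqType) s (site : I -> J) :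
  continuous (product_test s site : {ptws J -> R} -> R).
Proof.
apply: continuous_big; first exact: mul_continuous.
move=> i _ x.
apply: (@continuous_comp {ptws J -> R} R R (fun y => y (site i)) (g i)).
  exact: (@proj_continuous J (fun=> R) (site i)).
exact: cg.
Qed.

End product_tests.

Lemma windows_cover (d : nat) (s : seq (lattice d)) :
  exists m : nat, forall i, i \in s -> [forall j, `|i 0 j| <= m%:Z].
Proof.
elim: s => [|a s [m Hm]]; first by exists 0%N.
exists (m + \sum_j `|(a : 'rV[int]_d) 0%R j|)%N => i.
rewrite inE => /orP[/eqP ->|/Hm].
  apply/forallP => j; rewrite -abszE lez_nat (bigD1 j)//=.
  by rewrite addnCA leq_addr.
move=> /forallP im; apply/forallP => j.
by rewrite (le_trans (im j))// lez_nat leq_addr.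
Qed.

Section tail_limits.
Context (R : realType) (d : nat)
  (disp : measure_display) (T : measurableType disp) (P : probability T R)
  (disp' : measure_display) (T' : measurableType disp') (P' : probability T' R)
  (X : {RV P' >-> field_space R d}) (Y : {RV P >-> field_space R d}).
Hypothesis tailXY : tail_process X Y.

Lemma measurable_high_level (u : R) : measurable [set w | u < `|X w 0|].
Proof.
apply: (measurable_event X (A := [set x | u < `|x 0|])).
rewrite (_ : [set _ | _] =
  (fun x : field_space R d => `|x 0|) @^-1` `]u, +oo[); last first.
  by apply/seteqP; split=> x /=; rewrite in_itv/= andbT.
rewrite -[X in measurable X]setTI; apply: measurableT_comp => //.
exact: measurable_coordinate.
Qed.

Lemma measurable_scaled_field (u : R) :
  measurable_fun setT (fun w => (fun i => u^-1 * X w i) : field_space R d).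
Proof.
apply: measurable_fun_product => i; apply: measurable_funM => //.
apply: (measurableT_comp (f := fun x : field_space R d => x i)) => //.
exact: measurable_coordinate.
Qed.

Lemma measurable_restrict_window (m : nat) :
  measurable_fun setT (@restrict_window R d m).
Proof. by apply: measurable_fun_product => i; exact: measurable_coordinate. Qed.

(** The defining weak convergence, for products of continuous factors at
    arbitrary sites: a window containing the sites realises the product as a
    continuous function on a finite-dimensional space, and the conditioning
    event is only a normalisation because the product vanishes off it. *)
Lemma tail_process_product_test (I : eqType) (g : I -> R -> R) (s : seq I)
    (site : I -> lattice d) :
  (forall i, continuous (g i)) ->
  (forall i t, 0 <= g i t) -> (forall i t, g i t <= 1) ->
  (forall x : field_space R d, ~ 1 < `|x 0| -> product_test g s site x = 0) ->
  (((fine (P' [set w | (u < `|X w 0|)%R]))^-1)%:E *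
    \int[P']_w (product_test g s site (fun i => u^-1 * X w i)%R)%:E
      @[u --> +oo%R] -->
  \int[P]_w (product_test g s site (Y w))%:E)%E.
Proof.
move=> cg g0 g1 F0.
have [m Hm] := windows_cover (map site s).
have w0P : [forall j, `|(0 : lattice d) 0 j| <= m%:Z].
  by apply/forallP => j; rewrite mxE normr0.
pose w0 : window d m := exist _ 0 w0P.
pose siteW i : window d m := insubd w0 (site i).
have fE x :
    product_test g s siteW (restrict_window m x) = product_test g s site x.
  apply: eq_big_seq => i si; rewrite /restrict_window; congr (g i (x _)).
  by rewrite /siteW; apply: insubdK; apply: Hm; exact: map_f.
have [_ Xpos /(_ m) wc] := tailXY.
have fb : exists M : R, forall x, `|product_test g s siteW x| <= M.
  by exists 1 => x; rewrite ger0_norm ?product_test_le1 ?product_test_ge0.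
have {wc} := wc (product_test g s siteW)
  (continuous_product_test cg (s := s) (site := siteW)) fb.
have mf : measurable_fun setT
    (fun x : product_space (window d m) R => (product_test g s siteW x)%:E).
  by apply/measurable_EFinP; exact: measurable_product_test.
have f0 x : (0 <= (product_test g s siteW x)%:E)%E.
  by rewrite lee_fin product_test_ge0.
rewrite [X in _ --> X](_ : _ =
    \int[P]_w (product_test g s site (Y w))%:E)%E; last first.
  rewrite ge0_integral_pushforward//.
    by rewrite preimage_setT; apply: eq_integral => w _ /=; rewrite fE.
  by apply: measurableT_comp => //; exact: measurable_restrict_window.
apply: cvg_trans; apply: near_eq_cvg.
near=> u.
have u0 : 0 < u by near: u; exact: nbhs_pinfty_gt.
rewrite integral_conditional_pushforward//.
- congr (_ * _)%E; apply: eq_integral => w _; by rewrite fE.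
- exact: measurable_high_level.
- apply: (measurableT_comp (f := @restrict_window R d m)
    (g := fun w => (fun i => u^-1 * X w i) : field_space R d)).
    exact: measurable_restrict_window.
  exact: measurable_scaled_field.
- move=> w /= uX; rewrite fE F0//.
  by rewrite normrM gtr0_norm ?invr_gt0// mulrC ltr_pdivlMr// mul1r.
Unshelve. all: by end_near.
Qed.

Lemma integral_scaled_shift (F : field_space R d -> R) (u : R) (k : lattice d) :
  stationary X -> measurable_fun setT F -> (forall x, 0 <= F x) ->
  (\int[P']_w (F (fun i => u^-1 * X w (i + k))%R)%:E =
   \int[P']_w (F (fun i => u^-1 * X w i)%R)%:E)%E.
Proof.
move=> sX mF F0.
pose scale (x : field_space R d) : field_space R d := fun i => u^-1 * x i.
have mscaled : measurable_fun setT scale.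
  apply: measurable_fun_product => i; apply: measurable_funM => //.
  exact: measurable_coordinate.
have mFs : measurable_fun setT (EFin \o F \o scale).
  by apply: measurableT_comp => //; exact/measurable_EFinP.
have mXk : measurable_fun setT (fun w => field_shift k (X w)).
  by apply: measurableT_comp => //; exact: measurable_field_shift.
transitivity (\int[pushforward P' (fun w => field_shift k (X w))]_x
    (EFin \o F \o scale) x)%E.
  by rewrite ge0_integral_pushforward// => x _; rewrite lee_fin.
transitivity (\int[pushforward P' X]_x (EFin \o F \o scale) x)%E.
  by apply: eq_measure_integral => A mA _; exact: sX.
by rewrite ge0_integral_pushforward// => x _; rewrite lee_fin.
Qed.

(** Both the test function and its shift vanish unless |x 0| > 1, so both are
    covered by the weak convergence under the same normalisation. *)
Lemma tail_process_shift (I : eqType) (g : I -> R -> R) (s : seq I)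
    (site : I -> lattice d) (k : lattice d) :
  (forall i, continuous (g i)) ->
  (forall i t, 0 <= g i t) -> (forall i t, g i t <= 1) ->
  (forall x : field_space R d,
    ~ (1 < `|x 0| /\ 1 < `|x (- k)|) -> product_test g s site x = 0) ->
  stationary X ->
  (\int[P]_w (product_test g s site (field_shift k (Y w)))%:E =
   \int[P]_w (product_test g s site (Y w))%:E)%E.
Proof.
move=> cg g0 g1 F0 sX.
have cvg0 := tail_process_product_test (s := s) (site := site) cg g0 g1.
have cvgk := tail_process_product_test (s := s)
  (site := fun i => site i + k) cg g0 g1.
apply: (cvg_unique (@ereal_hausdorff R) (F := _ @ +oo)); last first.
  by apply: cvg0 => x x0; apply: F0 => -[].
apply: cvg_trans (cvgk _).
  apply: near_eq_cvg; near=> u; congr (_ * _)%E.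
  apply: (integral_scaled_shift u k sX (F := product_test g s site)).
    exact: measurable_product_test.
  by move=> x; exact: product_test_ge0.
move=> x x0; apply: (F0 (field_shift k x)) => -[_].
by rewrite /field_shift addNr.
Unshelve. all: by end_near.
Qed.

End tail_limits.

(** * Tail processes satisfy the transport identity *)

Section ramps.
Context (R : realType).

Definition ramp (n : nat) (t : R) : R := Num.min 1 (Num.max 0 (n%:R * t)).

Lemma ramp_ge0 n t : 0 <= ramp n t.
Proof. by rewrite /ramp le_min ler01 le_max lexx. Qed.

Lemma ramp_le1 n t : ramp n t <= 1.
Proof. by rewrite /ramp ge_min lexx. Qed.

Lemma ramp_le0 n t : t <= 0 -> ramp n t = 0.
Proof.
by move=> t0; rewrite /ramp max_l ?mulr_ge0_le0// min_r.
Qed.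

Lemma continuous_ramp n : continuous (ramp n).
Proof.
move=> t; apply: (@continuous_min R R (cst 1) (fun t => Num.max 0 (n%:R * t))).
  exact: cst_continuous.
apply: (@continuous_max R R (cst 0) (fun t => n%:R * t)).
  exact: cst_continuous.
exact: mulrl_continuous.
Qed.

(** The limit is attained: the value is eventually constant, so that it passes
    through finite products without a limit theorem. *)
Lemma ramp_near t : \forall n \near \oo, ramp n t = (0 < t)%R%:R.
Proof.
have [t0|t0] := ltP 0 t; last by near=> n; exact: ramp_le0.
near=> n; have nt : 1 <= n%:R * t.
  by rewrite -ler_pdivrMr// div1r; near: n; exact: nbhs_infty_ger.
by rewrite /ramp max_r ?(le_trans ler01)// min_l.
Unshelve. all: by end_near.
Qed.

End ramps.

Section threshold_events.
Context (R : realType) (d : nat).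
Local Notation threshold := (lattice d * option R)%type.

(** A threshold (i, Some a) stands for x i > a, and (i, None) for |x i| > 1. *)
Definition level (c : threshold) (t : R) : R :=
  if c.2 is Some a then t - a else `|t| - 1.

Definition above (s : seq threshold) (x : field_space R d) : bool :=
  all (fun c => 0 < level c (x c.1)) s.

Lemma continuous_level c : continuous (level c).
Proof.
case: c => i [a|] t; rewrite /level/=.
  by apply: cvgB; [exact: cvg_id|exact: cvg_cst].
by apply: cvgB; [exact: norm_continuous|exact: cvg_cst].
Qed.

Lemma continuous_ramp_level n c : continuous (ramp n \o level c).
Proof.
move=> t; apply: continuous_comp; first exact: continuous_level.
exact: continuous_ramp.
Qed.

Definition ramp_test n (s : seq threshold) (x : field_space R d) :=
  product_test (fun c => ramp n \o level c) s fst x.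

Lemma measurable_ramp_test n s : measurable_fun setT (ramp_test n s).
Proof. by apply: measurable_product_test; exact: continuous_ramp_level. Qed.

Lemma ramp_test_near s x :
  \forall n \near \oo, ramp_test n s x = (above s x)%:R.
Proof.
elim: s => [|c s IHs].
  by near=> n; rewrite /ramp_test /product_test big_nil.
near=> n; rewrite /ramp_test /product_test big_cons -/(product_test _ _ _ _).
rewrite -/(ramp_test n s x) /= -mulnb natrM.
congr (_ * _); near: n; last exact: IHs.
exact: ramp_near.
Unshelve. all: by end_near.
Qed.

Lemma cvg_ramp_test (disp : measure_display) (T : measurableType disp)
    (P : probability T R) (Z : T -> field_space R d) s :
  measurable_fun setT Z -> measurable [set w | above s (Z w)] ->
  (\int[P]_w (ramp_test n s (Z w))%:E @[n --> \oo] -->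
   P [set w | above s (Z w)])%E.
Proof.
move=> mZ mA.
have indE w : \1_[set w | above s (Z w)] w = (above s (Z w))%:R :> R.
  rewrite indicE; congr ((nat_of_bool _)%:R).
  by apply/idP/idP; rewrite inE.
rewrite -[X in _ --> P X]setIT -integral_indic//.
have [] := @dominated_convergence _ T R P setT measurableT
  (fun n w => (ramp_test n s (Z w))%:E)
  (fun w => (\1_[set w | above s (Z w)] w)%:E) (cst 1%E) => //.
- move=> n; apply/measurable_EFinP.
  by apply: measurableT_comp => //; exact: measurable_ramp_test.
- by apply/measurable_EFinP; exact: measurable_indic.
- apply: aeW => w _; apply: cvg_near_cst; rewrite indE.
  by near=> n; congr EFin; near: n; exact: ramp_test_near.
- exact: finite_measure_integrable_cst.
- apply: aeW => w n _; rewrite /= lee_fin ger0_norm.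
    by apply: product_test_le1 => [c t|c t]; rewrite ?ramp_ge0 ?ramp_le1.
  by apply: product_test_ge0 => c t; exact: ramp_ge0.
Unshelve. all: by end_near.
Qed.

End threshold_events.

(** Both exceedance laws are finite and are compared on the pi-system of ray
    cylinders, whose indicators, cut down by the exceedances at 0 and at -k,
    are limits of ramp tests. *)
Lemma tail_exceedance_transport (R : realType) (d : nat)
    (disp : measure_display) (T : measurableType disp) (P : probability T R)
    (Y : {RV P >-> field_space R d})
    (disp' : measure_display) (T' : measurableType disp')
    (P' : probability T' R) (X : {RV P' >-> field_space R d}) :
  stationary X -> tail_process X Y -> exceedance_transport Y.
Proof.
move=> sX tXY; have [Y0 _ _] := tXY.
have m0 : measurable (Y @^-1` fields0 R d).
  by apply: measurable_event; exact: (measurable_exceedance 0).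
apply: exceedance_lawP => k.
apply: (measure_unique (@ray_cylinders (lattice d) R) (fun=> setT)).
- exact: measurable_ray_cylinders.
- exact: setI_closed_ray_cylinders.
- by move=> _; exists [::]; apply/seteqP; split.
- by apply/seteqP; split => // x _; exists 0%N.
- move=> _ [s ->].
  pose l : seq (lattice d * option R) :=
    [:: (0, None), (- k, None) & [seq (p.1, Some p.2) | p <- s]].
  have aboveE (x : field_space R d) : above l x <->
      [/\ 1 < `|x 0|, 1 < `|x (- k)| & all (fun p => p.2 < x p.1) s].
    rewrite /above /= !subr_gt0 all_map /level /=.
    rewrite (eq_all (a2 := fun p => p.2 < x p.1)); last first.
      by move=> p /=; rewrite subr_gt0.
    by split=> [/and3P//|?]; apply/and3P.
  have mabove : measurable [set x : field_space R d | above l x].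
    rewrite (_ : [set _ | _] = [set x | 1 < `|x 0|] `&`
        [set x | 1 < `|x (- k)|] `&` [set x | all (fun p => p.2 < x p.1) s]).
      apply: measurableI; last exact: measurable_ray_cylinder.
      by apply: measurableI; exact: measurable_exceedance.
    by apply/seteqP; split=> x /=; rewrite aboveE; [case|case=> -[]].
  have mYk : measurable_fun setT (fun w => field_shift k (Y w)).
    by apply: measurableT_comp => //; exact: measurable_field_shift.
  have mEk : measurable [set w | above l (field_shift k (Y w))].
    by have := mYk measurableT _ mabove; rewrite setTI.
  have mE : measurable [set w | above l (Y w)].
    exact: (measurable_event Y mabove).
  have PE : P [set w | above l (field_shift k (Y w))] =
      P [set w | above l (Y w)].
    have mY : measurable_fun setT (Y : T -> field_space R d) by [].
    have := cvg_ramp_test (P := P) mYk mEk.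
    rewrite (_ : (fun n => _) =
        fun n => (\int[P]_w (ramp_test n l (Y w))%:E)%E); last first.
      apply/funext => n; apply: (tail_process_shift tXY) => //.
      + by move=> c; exact: continuous_ramp_level.
      + by move=> c t; exact: ramp_ge0.
      + by move=> c t; exact: ramp_le1.
      + move=> x /not_andP xl; rewrite /product_test !big_cons /=.
        case: xl => /negP; rewrite -leNgt => xl.
          by rewrite ramp_le0 ?mul0r// subr_le0.
        by rewrite mulrCA ramp_le0 ?mul0r// subr_le0.
    move=> cvgk; apply: cvg_unique cvgk (cvg_ramp_test (P := P) mY mE).
    exact: ereal_hausdorff.
  transitivity (P [set w | above l (field_shift k (Y w))]).
    apply: (eq_probability1 (N := Y @^-1` fields0 R d)) => //.
      by apply: measurable_transport_source; exact: measurable_ray_cylinder.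
    apply/seteqP; split=> w;
      rewrite /= aboveE /fields0 /= /field_shift add0r addNr.
      by case=> -[]; split.
    by case=> -[].
  rewrite PE.
  apply: (eq_probability1 (N := Y @^-1` fields0 R d)) => //.
    by apply: measurable_transport_source; exact: measurable_ray_cylinder.
  apply/seteqP; split=> w; rewrite /= aboveE /fields0 /= field_shift0.
    by case=> -[].
  by case=> -[]; split.
- by move=> _; exact: exceedance_law_fin.
Qed.

(** * The characterization *)

Theorem theorem2p3 (R : realType) (d : nat)
    (disp : measure_display) (T : measurableType disp) (P : probability T R)
    (Y : {RV P >-> field_space R d})
    (Y_fields0 : P (Y @^-1` fields0 R d) = 1%E) :
  (exceedance_stationary Y <->
   forall h : field_space R d -> R,
     measurable_fun [set: field_space R d] h -> (forall x, 0 <= h x) ->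
     forall k : lattice d,
       ('E_P[(fun w => h (field_shift k (Y w)) * (1 < `|Y w k|)%R%:R)%R] =
        'E_P[(fun w => h (Y w) * (1 < `|Y w (- k)|)%R%:R)%R])%E)
  /\
  (forall (disp' : measure_display) (T' : measurableType disp')
     (P' : probability T' R) (X : {RV P' >-> field_space R d}),
     stationary X -> tail_process X Y -> exceedance_stationary Y).
Proof.
split; [split=> [sY|EY]|move=> disp' T' P' X sX tXY].
- by apply/transport_expectationP; exact: stationary_exceedance_transport.
- by apply: transport_exceedance_stationary; apply/transport_expectationP.
- apply: transport_exceedance_stationary.
  exact: tail_exceedance_transport sX tXY.
Qed.
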